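(* For $\lambda>0$, let $N_\lambda$ denote a Poisson random variable with parameter $\lambda$. Then for every real $y>0$, $$\inf_{\lambda>0}\mathbf{P}\left(|N_\lambda-\mathbf{E}[N_\lambda]|\ge y\sqrt{\mathrm{Var}(N_\lambda)}\right)=0.$$
   Context: $\mathbf{P}$, $\mathbf{E}$ and $\mathrm{Var}$ denote probability, expectation and variance. The Poisson distribution with parameter $\lambda$ has $\mathbf{P}(N_\lambda=k)=e^{-\lambda}\lambda^k/k!$ for $k=0,1,2,\ldots$. *)

(* Defs.v *)
From HB Require Import structures.
From mathcomp Require Export all_boot all_order all_algebra.
From mathcomp Require Export all_classical all_reals all_analysis.
Export Order.TTheory GRing.Theory Num.Theory.
Export numFieldNormedType.Exports.

#[export] Set Implicit Arguments.
#[export] Unset Strict Implicit.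
#[export] Unset Printing Implicit Defensive.

(* Real-valued rather than nat-valued, so that 'E_P[X] and 'V_P[X] apply
   directly to X; the masses at the naturals sum to 1, so X is almost surely
   a natural number. The second argument of the library's poisson_pmf is the
   point k; for l > 0 it is l ^+ k / k`! * expR (- l). *)
Definition poisson_distributed (R : realType) (d : measure_display)
    (T : measurableType d) (P : probability T R) (X : {RV P >-> R}) (l : R) :
    Prop :=
  forall k : nat, pmf X (k%:R)%R = poisson_pmf l k.

(* Main.v *)
Require Import Defs.
From mathcomp Require Import measurable_realfun ring lra.

(** Small parameters make the deviation event rare. A Poisson variable of
    parameter [l] has mean and variance [l], so on the event [N = 0] the deviation
    equals [l], which is below [y * sqrt l] as soon as [l < y ^ 2]. The deviation
    event then lies in the complement of [N = 0], whose probability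
    [1 - exp (- l)] is at most [l] ([poisson_deviation_le]); letting [l] tend to
    [0] makes the infimum vanish.

    The hypothesis only prescribes the masses at the naturals, so the mean and
    variance have to be derived from them. These masses sum to [1], hence the
    variable is almost surely a natural number ([poisson_natural_as]), and the
    integral of a nonnegative function of it is a series over the naturals
    ([poisson_integral]). The moments then follow from the identity
    [E (N a(N)) = l E (a(N + 1))] ([poisson_pmf_shift]), taken at [a = 1] and at
    [a k = k]. *)

Local Open Scope classical_set_scope.
Local Open Scope ring_scope.
Local Open Scope ereal_scope.

Lemma poisson_pmf_sum (R : realType) (l : R) : (0 < l)%R ->
  \sum_(k <oo) (poisson_pmf l k)%:E = 1.
Proof.
move=> l0; rewrite nneseries_esumT; last first.
  by move=> k; rewrite lee_fin poisson_pmf_ge0.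
transitivity (poisson_prob l 0%N [set: nat]); first by rewrite /poisson_prob l0.
exact: probability_setT.
Qed.

Lemma poisson_pmfS (R : realType) (l : R) (k : nat) : (0 < l)%R ->
  (k.+1%:R * poisson_pmf l k.+1 = l * poisson_pmf l k)%R.
Proof.
move=> l0; rewrite /poisson_pmf l0 factS natrM exprS.
have k0 : (k.+1%:R : R)%R != 0%R by rewrite pnatr_eq0.
have f0 : (k`!%:R : R)%R != 0%R by rewrite pnatr_eq0 -lt0n fact_gt0.
by field; rewrite nat1r f0 k0.
Qed.

(** The Stein-Chen identity [E (N a(N)) = l E (a(N + 1))] for the Poisson law: the
    term of index [0] vanishes and [poisson_pmfS] turns each later one into the
    term of the right-hand series one index below. *)
Lemma poisson_pmf_shift (R : realType) (l : R) (a : nat -> R) : (0 < l)%R ->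
  (forall k, (0 <= a k)%R) ->
  \sum_(k <oo) (k%:R * a k * poisson_pmf l k)%:E =
  l%:E * \sum_(k <oo) (a k.+1 * poisson_pmf l k)%:E.
Proof.
move=> l0 a0; have p0 k : (0 <= poisson_pmf l k)%R by exact: poisson_pmf_ge0.
rewrite nneseries_recl//; last by move=> k _; rewrite lee_fin !mulr_ge0.
rewrite !mul0r add0e -(nneseries_addn 1); last first.
  by move=> k; rewrite lee_fin !mulr_ge0.
rewrite -nneseriesZl; last by move=> k _; rewrite lee_fin mulr_ge0.
apply: eq_eseriesr => k _; rewrite addn1 -EFinM; congr EFin.
by rewrite mulrAC poisson_pmfS// mulrAC mulrA.
Qed.

Lemma poisson_pmf_mean (R : realType) (l : R) : (0 < l)%R ->
  \sum_(k <oo) (k%:R * poisson_pmf l k)%:E = l%:E.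
Proof.
move=> l0; rewrite -[RHS]mule1 -[in RHS](poisson_pmf_sum l0).
transitivity (\sum_(k <oo) (k%:R * cst 1 k * poisson_pmf l k)%:E).
  by apply: eq_eseriesr => k _; rewrite mulr1.
rewrite (poisson_pmf_shift (a := cst 1%R))//; congr (_ * _).
by apply: eq_eseriesr => k _; rewrite mul1r.
Qed.

Section poisson_law.
Context {R : realType} {d : measure_display} {T : measurableType d}.
Context {P : probability T R} {X : {RV P >-> R}} {l : R}.
Hypotheses (l0 : (0 < l)%R) (hX : poisson_distributed X l).

Let A (k : nat) : set T := X @^-1` [set k%:R%R].

Let mA k : measurable (A k).
Proof. by rewrite -[A k]setTI; apply: measurable_funPT. Qed.

Let PA k : P (A k) = (poisson_pmf l k)%:E.
Proof. by rewrite -hX /pmf fineK// fin_num_measure. Qed.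

Let tA : trivIset [set: nat] A.
Proof.
apply/trivIsetP => i j _ _ /eqP ij; apply/seteqP; split=> // t [Xi Xj].
by apply: ij; apply/eqP; rewrite -(eqr_nat R) -(Xi : X t = _) (Xj : X t = _).
Qed.

Let mUA : measurable (\bigcup_k A k).
Proof. exact: bigcup_measurable. Qed.

Lemma poisson_natural_as : P (~` \bigcup_k X @^-1` [set k%:R%R]) = 0.
Proof.
rewrite -/(\bigcup_k A k) probability_setC// measure_bigcup//.
under eq_eseriesl do rewrite in_setT.
have -> : \sum_(k <oo) P (A k) = 1.
  by rewrite -(poisson_pmf_sum l0); apply: eq_eseriesr => k _; exact: PA.
by rewrite subee.
Qed.

(** The level sets of [X] at the naturals form a countable partition of a set of
    full measure, and the integrand is constant on each of them. Nonnegativity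
    of [h] allows the sum to be infinite, so no integrability has to be known
    beforehand. *)
Lemma poisson_integral (h : R -> R) : measurable_fun [set: R] h ->
  (forall x, (0 <= h x)%R) ->
  \int[P]_t (h (X t))%:E = \sum_(k <oo) (h k%:R * poisson_pmf l k)%:E.
Proof.
move=> mh h0.
have mhX D : measurable D -> measurable_fun D (EFin \o (h \o X)).
  move=> mD; apply: measurable_funTS; apply/measurable_EFinP.
  exact: measurableT_comp.
rewrite (ge0_negligible_integral (N := ~` \bigcup_k A k))//; last 4 first.
- exact: measurableC.
- exact: mhX.
- by move=> t _; rewrite lee_fin.
- exact: poisson_natural_as.
rewrite setTD setCK ge0_integral_bigcup//; last first.
- by move=> t _; rewrite lee_fin.
- exact: mhX.
apply: eq_eseriesr => k _.
rewrite (eq_integral (cst (h k%:R)%:E)); last first.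
  by move=> t /set_mem Xt; congr (h _)%:E; exact: Xt.
by rewrite integral_cst// EFinM; congr (_ * _); exact: PA.
Qed.

(** The absolute value is there to make the integrand nonnegative everywhere, as
    [poisson_integral] demands: [X] itself is nonnegative only almost surely. *)
Lemma poisson_expectation_abs : \int[P]_t (`|X t|%:E) = l%:E.
Proof.
rewrite (poisson_integral (h := Num.norm))//.
under eq_eseriesr do rewrite normr_nat.
exact: poisson_pmf_mean.
Qed.

Lemma poisson_expectation : 'E_P[X] = l%:E.
Proof.
rewrite expectation_def -poisson_expectation_abs; apply: ae_eq_integral => //.
- by apply/measurable_EFinP.
- by apply/measurable_EFinP; exact: measurableT_comp.
exists (~` \bigcup_k A k); split; [exact: measurableC|exact: poisson_natural_as|].
by apply: subsetC => t [k _] Xt _; rewrite (Xt : X t = k%:R%R) normr_nat.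
Qed.

Lemma poisson_second_moment : \int[P]_t ((X t ^+ 2)%R)%:E = (l ^+ 2 + l)%:E.
Proof.
rewrite (poisson_integral (h := fun x => x ^+ 2)%R)//; last first.
  by move=> x; exact: sqr_ge0.
under eq_eseriesr do rewrite expr2.
rewrite (poisson_pmf_shift (a := fun k => k%:R)%R)//.
under eq_eseriesr do rewrite -natr1 mulrDl mul1r EFinD.
have p0 k : (0 <= poisson_pmf l k)%R by exact: poisson_pmf_ge0.
rewrite nneseriesD; last 2 first.
- by move=> k _ _; rewrite lee_fin !mulr_ge0.
- by move=> k _ _; rewrite lee_fin.
rewrite poisson_pmf_mean// poisson_pmf_sum// -EFinD -EFinM; congr EFin; ring.
Qed.

(** Expanding [(X - l) ^ 2] would subtract integrals. Moving the cross term to the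
    other side, [(X - l) ^ 2 + 2 l X = X ^ 2 + l ^ 2], keeps every integrand
    nonnegative, once [X] is replaced by [|X|] in the cross term; the identity
    then holds on the naturals only, which is where the law is concentrated. *)
Lemma poisson_variance : 'V_P[X] = l%:E.
Proof.
rewrite /variance covariance.unlock poisson_expectation/= expectation.unlock.
set V := (V in V = _).
suff : V + (2 * l * l)%:E = (l ^+ 2 + l)%:E + (l ^+ 2)%:E.
  (* The right-hand side is finite, so an infinite variance is contradictory
     and the equation can be solved for [V]. *)
  case: V => // v; rewrite -!EFinD => -[] e; congr EFin.
  by apply: (addIr (2 * l * l)%R); rewrite e; ring.
have -> : V = \int[P]_t ((X t - l) ^+ 2)%:E.
  by apply: eq_integral => t _; rewrite /= expr2.
have mX : measurable_fun [set: T] X by [].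
have mlX : measurable_fun [set: T] (fun t => (2 * l * `|X t|)%:E).
  apply/measurable_EFinP; apply: measurable_funM => //.
  exact: measurableT_comp.
have l2 : (0 <= 2 * l)%R by rewrite mulr_ge0// ltW.
transitivity (\int[P]_t ((X t - l) ^+ 2 + 2 * l * `|X t|)%:E).
  under [RHS]eq_integral do rewrite EFinD.
  rewrite ge0_integralD//; last 3 first.
  - by move=> t _; rewrite lee_fin sqr_ge0.
  - by apply/measurable_EFinP; apply: measurable_funX; exact: measurable_funB.
  - by move=> t _; rewrite lee_fin mulr_ge0.
  congr (_ + _); under eq_integral do rewrite EFinM.
  rewrite ge0_integralZl//; last by apply/measurable_EFinP; exact: measurableT_comp.
  by rewrite poisson_expectation_abs -EFinM.
rewrite (poisson_integral (h := fun x => (x - l) ^+ 2 + 2 * l * `|x|)%R); last 2 first.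
- apply: measurable_funD; first by apply: measurable_funX; exact: measurable_funB.
  by apply: measurable_funM => //; exact: measurableT_comp.
- by move=> x; rewrite addr_ge0 ?sqr_ge0// mulr_ge0.
transitivity (\int[P]_t (X t ^+ 2 + l ^+ 2)%:E).
  rewrite (poisson_integral (h := fun x => x ^+ 2 + l ^+ 2)%R); last 2 first.
  - by apply: measurable_funD => //; exact: measurable_funX.
  - by move=> x; rewrite addr_ge0 ?sqr_ge0.
  by apply: eq_eseriesr => k _; rewrite normr_nat; congr EFin; ring.
under eq_integral do rewrite EFinD.
rewrite ge0_integralD//; last 3 first.
- by move=> t _; rewrite lee_fin sqr_ge0.
- by apply/measurable_EFinP; exact: measurable_funX.
- by move=> t _; rewrite lee_fin sqr_ge0.
rewrite poisson_second_moment integral_cst//; congr (_ + _).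
rewrite -[RHS]mule1; congr (_ * _); exact: probability_setT.
Qed.

(** On [X = 0] the deviation is [l < y * sqrt l], so the event is contained in the
    complement of [X = 0], which has probability [1 - exp (- l) <= l]. *)
Lemma poisson_deviation_le (y : R) : (l < y ^+ 2)%R -> (0 < y)%R ->
  P [set t | (`|X t - fine 'E_P[X]| >= y * Num.sqrt (fine 'V_P[X]))%R] <= l%:E.
Proof.
move=> ly y0; rewrite poisson_expectation poisson_variance/=.
have ly' : (l < y * Num.sqrt l)%R.
  rewrite -{1}(sqr_sqrtr (ltW l0)) expr2 ltr_pM2r ?sqrtr_gt0//.
  by rewrite -[ltRHS](ger0_norm (ltW y0)) -sqrtr_sqr ltr_sqrt// exprn_gt0.
apply: (@le_trans _ _ (P (~` A 0%N))).
  apply: le_measure; rewrite ?inE; last 2 first.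
  - exact: measurableC.
  - move=> t /= dev X0; move: dev.
    by rewrite X0 sub0r normrN (gtr0_norm l0) leNgt ly'.
  rewrite -[X in measurable X]setTI.
  apply: (@measurable_fun_le _ _ _ setT (cst (y * Num.sqrt l)%R)
           (fun t => `|X t - l|%R)) => //.
  by apply: measurableT_comp => //; exact: measurable_funB.
rewrite probability_setC// PA /poisson_pmf l0 expr0 fact0 invr1 !mul1r.
by rewrite -EFinB lee_fin; have := expR_ge1Dx (- l); lra.
Qed.

End poisson_law.

Theorem proposition3p2 (R : realType) (d : R -> measure_display)
    (T : forall l : R, measurableType (d l))
    (P : forall l : R, probability (T l) R)
    (N : forall l : R, {RV (P l) >-> R})
    (hN : forall l : R, (0 < l)%R -> poisson_distributed (N l) l)
    (y : R) (hy : (0 < y)%R) :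
  ereal_inf
    [set P l [set t : T l |
               (`|N l t - fine 'E_(P l)[N l]|
                  >= y * Num.sqrt (fine 'V_(P l)[N l]))%R]
    | l in [set l : R | (0 < l)%R]] = 0.
Proof.
apply/eqP; rewrite eq_le; apply/andP; split; last first.
  by apply: le_ereal_inf_tmp => _ [l _ <-]; exact: measure_ge0.
apply/lee_addgt0Pr => e e0; rewrite add0e.
have y2 : (0 < y ^+ 2)%R by rewrite exprn_gt0.
(* The second argument of the minimum gives the strict bound [l < y ^ 2]. *)
pose l := Num.min e (y ^+ 2 / 2)%R.
have l0 : (0 < l)%R by rewrite lt_min e0 divr_gt0.
have ly : (l < y ^+ 2)%R.
  by rewrite gt_min; apply/orP; right; rewrite ltr_pdivrMr//; lra.
apply: ge_ereal_inf; exists (P l [set t | (`|N l t - fine 'E_(P l)[N l]|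
    >= y * Num.sqrt (fine 'V_(P l)[N l]))%R]); first by exists l.
apply: (le_trans (poisson_deviation_le l0 (hN l l0) ly hy)).
by rewrite lee_fin ge_min lexx.
Qed.
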